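(* Assume that the Clifford relations $$(s^i\wedge s^j)\triangleright e^\alpha:=C^{j\alpha}{}_\beta C^{i\beta}{}_\gamma\varphi^\gamma{}_\delta\,e^\delta-\kappa g^{ij}e^\alpha$$ give a well-defined action $\Omega^2\otimes_A\mathcal S\to\mathcal S$, and that $\nabla$ is torsion free. Let $R_{\mathcal S}=(d\otimes\mathrm{id}-\mathrm{id}\wedge\nabla_{\mathcal S})\nabla_{\mathcal S}$ be the curvature of $\nabla_{\mathcal S}$, with coefficients defined by $(\triangleright\circ R_{\mathcal S})(e^\alpha)=R_{\mathcal S}{}^\alpha{}_\beta e^\beta$. Then $$R_{\mathcal S}{}^\alpha{}_\eta=\Big(\partial_iS^\alpha{}_{j\beta}-\tfrac12S^\alpha{}_{k\beta}\Gamma^k{}_{ij}-S^\alpha{}_{i\tau}S^\tau{}_{j\beta}\Big)\Big(C^{j\beta}{}_\gamma C^{i\gamma}{}_\delta\varphi^\delta{}_\eta-\kappa g^{ij}\delta^\beta{}_\eta\Big)$$ (summation over repeated indices).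
   Context: $A$ is a unital algebra over $\mathbb{C}$ with centre $\mathbb{C}1$; $(\Omega,d)$ is an exterior algebra over $A$ (differential graded algebra generated by $A,dA$) with $\Omega^1$ free with a central basis $\{s^i\}$. Partial derivatives are defined by $da=(\partial_ia)s^i$. The quantum metric is $g=g_{ij}s^i\otimes s^j$, and its inverse is the bimodule map $(\ ,\ )$ with $g^{ij}=(s^i,s^j)\in\mathbb{C}$. A bimodule connection $\nabla:\Omega^1\to\Omega^1\otimes_A\Omega^1$ obeys $\nabla(a\omega)=a\nabla\omega+da\otimes\omega$, $\nabla(\omega a)=(\nabla\omega)a+\sigma(\omega\otimes da)$ for a bimodule map $\sigma$; $\nabla s^i=-\frac12\Gamma^i{}_{jk}s^j\otimes s^k$, $\Gamma^i{}_{jk}\in A$; torsion free means $\wedge\nabla=d$ on $\Omega^1$. $\mathcal S$ is an $A$-bimodule, free with central basis $\{e^\alpha\}$, with bimodule connection $\nabla_{\mathcal S}e^\alpha=S^\alpha{}_{i\beta}s^i\otimes e^\beta$, $S^\alpha{}_{i\beta}\in A$ (the same Leibniz rules, with a bimodule map $\sigma_{\mathcal S}:\mathcal S\otimes_A\Omega^1\to\Omega^1\otimes_A\mathcal S$). The Clifford action is a bimodule map $\triangleright:\Omega^1\otimes_A\mathcal S\to\mathcal S$, $s^i\triangleright e^\alpha=C^{i\alpha}{}_\beta e^\beta$, $C^{i\alpha}{}_\beta\in\mathbb{C}$. $\varphi:\mathcal S\to\mathcal S$ is a bimodule automorphism, $\varphi(e^\alpha)=\varphi^\alpha{}_\beta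 e^\beta$, $\varphi^\alpha{}_\beta\in\mathbb{C}$, and $\kappa$ is a nonzero constant. *)

(* Defs.v *)
From HB Require Import structures.
From mathcomp Require Import all_boot all_order all_algebra.
From mathcomp Require Import boolp.

Set Implicit Arguments.
Unset Strict Implicit.
Unset Printing Implicit Defensive.

Import GRing.Theory.
Local Open Scope ring_scope.
Local Open Scope quotient_scope.

Reserved Notation "m *> a" (at level 40, left associativity).
Reserved Notation "m ⊗ n" (at level 40, left associativity).

(** * Bimodules over a possibly noncommutative ring *)

HB.mixin Record Lmodule_isBimodule (A : pzRingType) M of GRing.Lmodule A M := {
  ract : M -> A -> M;
  ractDl : forall (a : A) (m n : M), ract (m + n) a = ract m a + ract n a;
  ractDr : forall (m : M) (a b : A), ract m (a + b) = ract m a + ract m b;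
  ractA : forall (m : M) (a b : A), ract (ract m a) b = ract m (a * b);
  ract1 : forall m : M, ract m 1 = m;
  scale_ractA : forall (a : A) (m : M) (b : A),
    ract (a *: m) b = a *: ract m b
}.

#[short(type="bimodType")]
HB.structure Definition Bimodule (A : pzRingType) :=
  { M of GRing.Lmodule A M & Lmodule_isBimodule A M }.

Notation "m *> a" := (ract m a) : ring_scope.

HB.instance Definition _ (A : pzRingType) :=
  Lmodule_isBimodule.Build A A^o
    (fun a x y => mulrDl x y a) (fun m a b => mulrDr m a b)
    (fun m a b => esym (mulrA m a b)) (fun m => mulr1 m)
    (fun a m b => esym (mulrA a m b)).

Section BimoduleTheory.
Variables (A : pzRingType) (M N : bimodType A).

Lemma ract0l (a : A) : (0 : M) *> a = 0.
Proof. by apply: (addrI ((0 : M) *> a)); rewrite -ractDl !addr0. Qed.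

Lemma ractNl (m : M) (a : A) : (- m) *> a = - (m *> a).
Proof. by apply/eqP; rewrite -subr_eq0 opprK -ractDl addNr ract0l. Qed.

Definition bimodule_map (f : M -> N) : Prop :=
  linear f /\ (forall m a, f (m *> a) = f m *> a).

Definition central_basis (I : finType) (s : I -> M) : Prop :=
  (forall m : M, exists! a : {ffun I -> A}, m = \sum_i a i *: s i)
  /\ (forall (a : A) i, a *: s i = s i *> a).

End BimoduleTheory.

(** * The tensor product [M ⊗_A N]

  Finite lists of pairs stand for finite formal sums of symbols [m ⊗ n]; they
  are identified by the additive congruence generated by biadditivity and
  [(m a) ⊗ n = m ⊗ (a n)]. *)

Section Tensor.
Variables (A : pzRingType) (M N : bimodType A).

Inductive tensor_rel : seq (M * N) -> seq (M * N) -> Prop :=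
| TRefl s : tensor_rel s s
| TSym s t : tensor_rel s t -> tensor_rel t s
| TTrans s t u : tensor_rel s t -> tensor_rel t u -> tensor_rel s u
| TCat s s' t t' :
    tensor_rel s s' -> tensor_rel t t' -> tensor_rel (s ++ t) (s' ++ t')
| TComm s t : tensor_rel (s ++ t) (t ++ s)
| TAddl m m' n : tensor_rel [:: (m + m', n)] [:: (m, n); (m', n)]
| TAddr m n n' : tensor_rel [:: (m, n + n')] [:: (m, n); (m, n')]
| TZero n : tensor_rel [:: (0, n)] [::]
| TBal m a n : tensor_rel [:: (m *> a, n)] [:: (m, a *: n)].

Definition tensor_relb (s t : seq (M * N)) : bool := `[< tensor_rel s t >].

Lemma tensor_relb_refl : reflexive tensor_relb.
Proof. by move=> s; apply/asboolP; apply: TRefl. Qed.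

Lemma tensor_relb_sym : symmetric tensor_relb.
Proof. by move=> s t; apply/asboolP/asboolP; apply: TSym. Qed.

Lemma tensor_relb_trans : transitive tensor_relb.
Proof.
by move=> t s u /asboolP st /asboolP tu; apply/asboolP; apply: TTrans st tu.
Qed.

Canonical tensor_equiv :=
  EquivRel tensor_relb tensor_relb_refl tensor_relb_sym tensor_relb_trans.

Definition tensor := {eq_quot tensor_relb}.

HB.instance Definition _ := Choice.on tensor.
HB.instance Definition _ := EqQuotient.on tensor.

Definition tcls (s : seq (M * N)) : tensor := \pi_tensor s.

Lemma tclsP s t : tensor_rel s t <-> tcls s = tcls t.
Proof.
split=> [st|/eqmodP/asboolP //]; by apply/eqmodP/asboolP.
Qed.

Lemma tcls_repr (x : tensor) : tcls (repr x) = x.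
Proof. exact: reprK. Qed.

Lemma repr_tcls s : tensor_rel (repr (tcls s)) s.
Proof. by apply/tclsP; rewrite tcls_repr. Qed.

Lemma tensorW (P : tensor -> Prop) : (forall s, P (tcls s)) -> forall x, P x.
Proof. by move=> h x; rewrite -(tcls_repr x). Qed.

Definition tadd (x y : tensor) : tensor := tcls (repr x ++ repr y).

Lemma taddE s t : tadd (tcls s) (tcls t) = tcls (s ++ t).
Proof. by apply/tclsP; apply: TCat; apply: repr_tcls. Qed.

Definition act_seq (f : M -> M) (g : N -> N) (s : seq (M * N)) :=
  [seq (f p.1, g p.2) | p <- s].

Definition tact (f : M -> M) (g : N -> N) (x : tensor) : tensor :=
  tcls (act_seq f g (repr x)).

Section Act.
Variables (f : M -> M) (g : N -> N).
Hypothesis fD : forall m m', f (m + m') = f m + f m'.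
Hypothesis gD : forall n n', g (n + n') = g n + g n'.
Hypothesis fR : forall m a, f (m *> a) = f m *> a.
Hypothesis gL : forall a n, g (a *: n) = a *: g n.

Lemma act_seq_rel s t :
  tensor_rel s t -> tensor_rel (act_seq f g s) (act_seq f g t).
Proof.
have f0 : f 0 = 0 by apply: (addrI (f 0)); rewrite -fD !addr0.
elim=> {s t} /= [s|s t _|s t u _ st _|s s' t t' _ h _ h'|s t|m m' n|m n n'|n
  |m a n].
- exact: TRefl.
- exact: TSym.
- exact: TTrans.
- by rewrite /act_seq !map_cat; apply: TCat.
- by rewrite /act_seq !map_cat; apply: TComm.
- by rewrite /act_seq /= fD; apply: TAddl.
- by rewrite /act_seq /= gD; apply: TAddr.
- by rewrite /act_seq /= f0; apply: TZero.
- by rewrite /act_seq /= fR gL; apply: TBal.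
Qed.

Lemma tactE s : tact f g (tcls s) = tcls (act_seq f g s).
Proof. by apply/tclsP/act_seq_rel/repr_tcls. Qed.
End Act.

Definition topp : tensor -> tensor := tact (fun m => - m) id.

Lemma toppE s : topp (tcls s) = tcls (act_seq (fun m => - m) id s).
Proof. by apply: tactE => // [m m'|m a]; rewrite ?opprD ?ractNl. Qed.

Lemma taddA : associative tadd.
Proof.
elim/tensorW=> s; elim/tensorW=> t; elim/tensorW=> u.
by rewrite !taddE catA.
Qed.

Lemma taddC : commutative tadd.
Proof.
elim/tensorW=> s; elim/tensorW=> t; rewrite !taddE.
by apply/tclsP/TComm.
Qed.

Lemma tadd0 : left_id (tcls [::]) tadd.
Proof. by elim/tensorW=> s; rewrite taddE. Qed.

Lemma taddN : left_inverse (tcls [::]) topp tadd.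
Proof.
elim/tensorW=> s; rewrite toppE taddE; apply/tclsP.
elim: s => [|[m n] s ih]; first exact: TRefl.
have mN : tensor_rel ([:: (- m, n)] ++ [:: (m, n)]) [::].
  apply: TTrans (TZero n); rewrite -(addNr m); exact/TSym/TAddl.
rewrite /act_seq /= -/(act_seq _ _ _) -cat1s -(cat1s (m, n)).
apply: (TTrans (TCat (TRefl _) _) mN).
set s' := act_seq _ _ s in ih *.
apply: (@TTrans _ ([:: (m, n)] ++ (s' ++ s))).
  rewrite !catA; apply: TCat (TRefl _); exact: TComm.
by rewrite -[X in tensor_rel _ X]cats0; apply: TCat => //; apply: TRefl.
Qed.

HB.instance Definition _ :=
  GRing.isZmodule.Build tensor taddA taddC tadd0 taddN.

Lemma tclsD s t : tcls (s ++ t) = tcls s + tcls t.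
Proof. by rewrite -taddE. Qed.

Lemma tcls_ind (P : tensor -> Prop) :
  P 0 -> (forall m n, P (tcls [:: (m, n)])) ->
  (forall x y, P x -> P y -> P (x + y)) -> forall x, P x.
Proof.
move=> P0 P1 PD; elim/tensorW=> s; elim: s => [//|[m n] s ih].
by rewrite -cat1s tclsD; apply: PD.
Qed.

Definition tscale (a : A) : tensor -> tensor := tact (fun m => a *: m) id.
Definition tract (x : tensor) (a : A) : tensor := tact id (fun n => n *> a) x.

Lemma tscaleE a s : tscale a (tcls s) = tcls (act_seq (fun m => a *: m) id s).
Proof. by apply: tactE => // m m'; rewrite ?scalerDr ?scale_ractA. Qed.

Lemma tractE s a : tract (tcls s) a = tcls (act_seq id (fun n => n *> a) s).
Proof. by apply: tactE => // [n n'|b n]; rewrite ?ractDl ?scale_ractA. Qed.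

Lemma tscaleDr a : {morph tscale a : x y / x + y}.
Proof.
elim/tensorW=> s; elim/tensorW=> t.
by rewrite -tclsD !tscaleE /act_seq map_cat tclsD.
Qed.

Lemma tractDl a : {morph tract^~ a : x y / x + y}.
Proof.
elim/tensorW=> s; elim/tensorW=> t.
by rewrite -tclsD !tractE /act_seq map_cat tclsD.
Qed.

Lemma tscale0 a : tscale a 0 = 0.
Proof. exact: (tscaleE a [::]). Qed.

Lemma tract0 a : tract 0 a = 0.
Proof. exact: (tractE [::] a). Qed.

Lemma tscaleA a b x : tscale a (tscale b x) = tscale (a * b) x.
Proof.
elim/tcls_ind: x => [|m n|x y hx hy]; first by rewrite !tscale0.
  by rewrite !tscaleE /= scalerA.
by rewrite !tscaleDr hx hy.
Qed.

Lemma tscale1 : left_id 1 tscale.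
Proof.
elim/tcls_ind=> [|m n|x y hx hy]; first by rewrite tscale0.
  by rewrite tscaleE /= scale1r.
by rewrite tscaleDr hx hy.
Qed.

Lemma tscaleDl x : {morph tscale^~ x : a b / a + b}.
Proof.
move=> a b; elim/tcls_ind: x => [|m n|x y hx hy].
- by rewrite !tscale0 addr0.
- rewrite !tscaleE /= -tclsD scalerDl; apply/tclsP/TAddl.
- by rewrite !tscaleDr hx hy addrACA.
Qed.

HB.instance Definition _ :=
  GRing.Zmodule_isLmodule.Build A tensor
    tscaleA tscale1 tscaleDr tscaleDl.

Lemma tractDr x a b : tract x (a + b) = tract x a + tract x b.
Proof.
elim/tcls_ind: x => [|m n|x y hx hy].
- by rewrite !tract0 addr0.
- rewrite !tractE /= -tclsD ractDr; apply/tclsP/TAddr.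
- by rewrite !tractDl hx hy addrACA.
Qed.

Lemma tractA x a b : tract (tract x a) b = tract x (a * b).
Proof.
elim/tcls_ind: x => [|m n|x y hx hy]; first by rewrite !tract0.
  by rewrite !tractE /= ractA.
by rewrite !tractDl hx hy.
Qed.

Lemma tract1 x : tract x 1 = x.
Proof.
elim/tcls_ind: x => [|m n|x y hx hy]; first by rewrite tract0.
  by rewrite tractE /= ract1.
by rewrite tractDl hx hy.
Qed.

Lemma tscale_ractA (a : A) (x : tensor) (b : A) :
  tract (a *: x) b = a *: tract x b.
Proof.
elim/tcls_ind: x => [|m n|x y hx hy].
- by rewrite /GRing.scale /= tract0 !tscale0 tract0.
- by rewrite /GRing.scale /= !(tscaleE, tractE).
- by rewrite scalerDr !tractDl scalerDr hx hy.
Qed.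

HB.instance Definition _ :=
  Lmodule_isBimodule.Build A tensor
    tractDl tractDr tractA tract1 tscale_ractA.

Definition tens (m : M) (n : N) : tensor := tcls [:: (m, n)].
Local Notation "m ⊗ n" := (tens m n).

Lemma tensDl m m' n : (m + m') ⊗ n = m ⊗ n + m' ⊗ n.
Proof. rewrite /tens -tclsD; apply/tclsP/TAddl. Qed.

Lemma tensDr m n n' : m ⊗ (n + n') = m ⊗ n + m ⊗ n'.
Proof. rewrite /tens -tclsD; apply/tclsP/TAddr. Qed.

Lemma tens_bal m a n : (m *> a) ⊗ n = m ⊗ (a *: n).
Proof. exact/tclsP/TBal. Qed.

Lemma tensZl a m n : (a *: m) ⊗ n = a *: (m ⊗ n).
Proof. by rewrite [RHS]tscaleE. Qed.

Lemma tens_ract m n a : m ⊗ (n *> a) = (m ⊗ n) *> a.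
Proof. by rewrite [RHS]tractE. Qed.

Lemma tens_ind (P : tensor -> Prop) :
  P 0 -> (forall m n, P (m ⊗ n)) ->
  (forall x y, P x -> P y -> P (x + y)) -> forall x, P x.
Proof. exact: tcls_ind. Qed.

Section Lift.
Variables (P : zmodType) (f : M -> N -> P).

Definition balanced : Prop :=
  [/\ forall m m' n, f (m + m') n = f m n + f m' n,
      forall m n n', f m (n + n') = f m n + f m n'
    & forall m a n, f (m *> a) n = f m (a *: n)].

(* Only meaningful when [f] is balanced: [tlift f] is then the unique additive
   map with [tlift f (m ⊗ n) = f m n]. *)
Definition tlift (x : tensor) : P := \sum_(p <- repr x) f p.1 p.2.

Hypothesis fP : balanced.

Let eval (s : seq (M * N)) : P := \sum_(p <- s) f p.1 p.2.

Let eval_rel s t : tensor_rel s t -> eval s = eval t.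
Proof.
have [fl fr fb] := fP; rewrite /eval.
elim=> {s t} /= [s|s t _|s t u _ -> _|s s' t t' _ h _ h'|s t|m m' n|m n n'|n
  |m a n] //.
- by rewrite !big_cat /= h h'.
- by rewrite !big_cat /= addrC.
- by rewrite !big_cons !big_nil !addr0 fl.
- by rewrite !big_cons !big_nil !addr0 fr.
- rewrite big_cons !big_nil addr0 /=.
  by apply: (addrI (f 0 n)); rewrite -fl !addr0.
- by rewrite !big_cons !big_nil !addr0 fb.
Qed.

Let tlift_cls s : tlift (tcls s) = eval s.
Proof. exact/eval_rel/repr_tcls. Qed.

Lemma tliftE m n : tlift (m ⊗ n) = f m n.
Proof. by rewrite tlift_cls /eval big_seq1. Qed.

Lemma tlift0 : tlift 0 = 0.
Proof. by rewrite [LHS](tlift_cls [::]) /eval big_nil. Qed.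

Lemma tliftD : {morph tlift : x y / x + y}.
Proof.
elim/tensorW=> s; elim/tensorW=> t.
by rewrite -tclsD !tlift_cls /eval big_cat.
Qed.

Lemma tlift_uniq (h : tensor -> P) :
  {morph h : x y / x + y} -> (forall m n, h (m ⊗ n) = f m n) -> h =1 tlift.
Proof.
move=> hD hE; elim/tens_ind=> [|m n|x y hx hy].
- by rewrite tlift0; apply: (addrI (h 0)); rewrite -hD !addr0.
- by rewrite hE tliftE.
- by rewrite hD tliftD hx hy.
Qed.
End Lift.

End Tensor.

Arguments tens {A M N} m n : simpl never.
Notation "m ⊗ n" := (tens m n) : ring_scope.

(** * Exterior algebras (differential graded algebras generated by [A], [dA])

  The product of forms takes a proof of [m + n = p] as an argument, so that the
  axioms compare elements of the same space of forms without casts. *)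

Record exterior_algebra (K : fieldType) (A : algType K) := ExteriorAlgebra {
  form :> nat -> bimodType A;
  wedge : forall m n p, m + n = p -> form m -> form n -> form p;
  dif : forall n, form n -> form n.+1;
  of_alg : A -> form 0;
  of_algD : forall a b, of_alg (a + b) = of_alg a + of_alg b;
  of_algM : forall a b (e : 0 + 0 = 0),
    wedge e (of_alg a) (of_alg b) = of_alg (a * b);
  of_alg_bij : bijective of_alg;
  wedge_scale : forall a n (e : 0 + n = n) (x : form n),
    wedge e (of_alg a) x = a *: x;
  wedge_ract : forall a n (e : n + 0 = n) (x : form n),
    wedge e x (of_alg a) = x *> a;
  wedgeDl : forall m n p (e : m + n = p) (x x' : form m) (y : form n),
    wedge e (x + x') y = wedge e x y + wedge e x' y;
  wedgeDr : forall m n p (e : m + n = p) (x : form m) (y y' : form n),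
    wedge e x (y + y') = wedge e x y + wedge e x y';
  wedgeA : forall m n p mn np r (e1 : m + n = mn) (e2 : mn + p = r)
      (e3 : n + p = np) (e4 : m + np = r)
      (x : form m) (y : form n) (z : form p),
    wedge e2 (wedge e1 x y) z = wedge e4 x (wedge e3 y z);
  difD : forall n (x y : form n), dif (x + y) = dif x + dif y;
  difZ : forall (c : K) n (x : form n), dif (c%:A *: x) = c%:A *: dif x;
  dif_dif : forall n (x : form n), dif (dif x) = 0;
  dif_wedge : forall m n p (e : m + n = p) (e1 : m.+1 + n = p.+1)
      (e2 : m + n.+1 = p.+1) (x : form m) (y : form n),
    dif (wedge e x y)
      = wedge e1 (dif x) y + (-1) ^+ m *: wedge e2 x (dif y);
  form_generated : forall P : (forall n, form n -> Prop),
    (forall a, P 0 (of_alg a)) ->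
    (forall a, P 1 (dif (of_alg a))) ->
    (forall n, P n 0) ->
    (forall n (x y : form n), P n x -> P n y -> P n (x + y)) ->
    (forall m n p (e : m + n = p) x y, P m x -> P n y -> P p (wedge e x y)) ->
    forall n (x : form n), P n x
}.

Arguments wedge {K A} _ {m n p}.
Arguments dif {K A} _ {n}.
Arguments of_alg {K A} _.

Section Calculus.
Variables (K : fieldType) (A : algType K) (Omega : exterior_algebra A).

Definition d0 (a : A) : Omega 1%N := dif Omega (of_alg Omega a).

Definition wedge2 (x y : Omega 1%N) : Omega 2%N :=
  wedge Omega (erefl (1 + 1)%N) x y.

Definition center_is_scalars : Prop :=
  forall a : A, (forall b, a * b = b * a) <-> exists c : K, a = c%:A.

Definition bimodule_connection (E : bimodType A)
    (nabla : E -> tensor (Omega 1%N) E)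
    (sigma : tensor E (Omega 1%N) -> tensor (Omega 1%N) E) : Prop :=
  [/\ forall x y, nabla (x + y) = nabla x + nabla y,
      forall a x, nabla (a *: x) = a *: nabla x + d0 a ⊗ x,
      bimodule_map sigma
    & forall x a, nabla (x *> a) = nabla x *> a + sigma (x ⊗ d0 a)].

Definition torsion_free
    (nabla : Omega 1%N -> tensor (Omega 1%N) (Omega 1%N)) : Prop :=
  forall w, tlift wedge2 (nabla w) = dif Omega w.

(* [w ∧ t] for [t] in [Omega^1 ⊗ E]: [w ∧ (y ⊗ x) = (w ∧ y) ⊗ x]. *)
Definition wedge_tens (E : bimodType A) (w : Omega 1%N)
    (t : tensor (Omega 1%N) E) : tensor (Omega 2%N) E :=
  tlift (fun y x => wedge2 w y ⊗ x) t.

(* [d ⊗ id] and [id ∧ nabla] do not separately descend to [Omega^1 ⊗_A E];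
   only their difference is balanced over [A] (see [curvature_balanced]). *)
Definition curvature (E : bimodType A)
    (nabla : E -> tensor (Omega 1%N) E) (x : E) : tensor (Omega 2%N) E :=
  tlift (fun w y => dif Omega w ⊗ y - wedge_tens w (nabla y)) (nabla x).

(* [g = sum g_ij s^i ⊗ s^j], with inverse [ip] in the sense
   [(w, g^1) g^2 = w = g^1 (g^2, w)]. *)
Definition quantum_metric (I : finType) (s : I -> Omega 1%N)
    (glow : I -> I -> A)
    (ip : tensor (Omega 1%N) (Omega 1%N) -> A^o) : Prop :=
  bimodule_map ip /\
  forall w : Omega 1%N,
    \sum_i \sum_j ip (w ⊗ (glow i j *: s i)) *: s j = w /\
    \sum_i \sum_j (glow i j *: s i) *> ip (s j ⊗ w) = w.

Lemma wedge2_balanced : balanced wedge2.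
Proof.
split=> *; rewrite /wedge2; first exact: wedgeDl.
  exact: wedgeDr.
rewrite -(wedge_ract _ (addn0 1)) -(wedge_scale _ (add0n 1)).
exact: wedgeA.
Qed.

Lemma wedge2_scalel a x y : wedge2 (a *: x) y = a *: wedge2 x y.
Proof.
rewrite /wedge2 -(wedge_scale _ (add0n 1)) -(wedge_scale _ (add0n 2)).
exact: wedgeA.
Qed.

Lemma wedge2_ractr x y a : wedge2 x (y *> a) = wedge2 x y *> a.
Proof.
rewrite /wedge2 -(wedge_ract _ (addn0 1)) -(wedge_ract _ (addn0 2)).
by symmetry; apply: wedgeA.
Qed.

Section Balanced.
Variables (E : bimodType A) (nabla : E -> tensor (Omega 1%N) E).

Lemma wedge_tens_balanced w : balanced (fun y (x : E) => wedge2 w y ⊗ x).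
Proof.
split=> [m m' n|m n n'|m a n] /=; last by rewrite wedge2_ractr tens_bal.
  by have [_ -> _] := wedge2_balanced; rewrite tensDl.
by rewrite tensDr.
Qed.

Lemma wedge_tensDl w w' (t : tensor _ E) :
  wedge_tens (w + w') t = wedge_tens w t + wedge_tens w' t.
Proof.
rewrite /wedge_tens; elim/tens_ind: t => [|y x|t u ht hu].
- by rewrite !(tlift0 (wedge_tens_balanced _)) addr0.
- rewrite !(tliftE (wedge_tens_balanced _)) -tensDl.
  by have [-> _ _] := wedge2_balanced.
- by rewrite !(tliftD (wedge_tens_balanced _)) ht hu addrACA.
Qed.

Lemma wedge_tens_ract w a (t : tensor _ E) :
  wedge_tens (w *> a) t = wedge_tens w (a *: t).
Proof.
rewrite /wedge_tens; elim/tens_ind: t => [|y x|t u ht hu].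
- by rewrite scaler0 !(tlift0 (wedge_tens_balanced _)).
- rewrite -tensZl !(tliftE (wedge_tens_balanced _)).
  by have [_ _ ->] := wedge2_balanced.
- by rewrite scalerDr !(tliftD (wedge_tens_balanced _)) ht hu.
Qed.

Lemma d_ract (w : Omega 1%N) a :
  dif Omega (w *> a) = dif Omega w *> a - wedge2 w (d0 a).
Proof.
rewrite -(wedge_ract _ (addn0 1)) (dif_wedge _ (addn0 2) (erefl (1 + 1)%N)).
by rewrite expr1 scaleN1r wedge_ract.
Qed.

Lemma d_scale a (w : Omega 1%N) :
  dif Omega (a *: w) = wedge2 (d0 a) w + a *: dif Omega w.
Proof.
rewrite -(wedge_scale _ (add0n 1)) (dif_wedge _ (erefl (1 + 1)%N) (add0n 2)).
by rewrite expr0 scale1r wedge_scale.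
Qed.

Lemma curvature_balanced sigma : bimodule_connection nabla sigma ->
  balanced (fun w y => dif Omega w ⊗ y - wedge_tens w (nabla y)).
Proof.
move=> [nD nZ _ _]; split=> [w w' y|w y y'|w a y].
- by rewrite difD tensDl wedge_tensDl opprD addrACA.
- rewrite tensDr nD /wedge_tens (tliftD (wedge_tens_balanced _)) opprD.
  by rewrite addrACA.
- rewrite nZ wedge_tens_ract d_ract /wedge_tens.
  rewrite (tliftD (wedge_tens_balanced _)) (tliftE (wedge_tens_balanced _)).
  rewrite tensDl tens_bal opprD [in RHS]addrA addrAC; congr (_ - _).
  rewrite [RHS]addrC addrC; congr (_ + _).
  by apply/eqP; rewrite -subr_eq0 opprK -tensDl addNr -(scale0r 0) tensZl scale0r.
Qed.
End Balanced.

End Calculus.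

(* Main.v *)
Require Import Defs.
From mathcomp Require Import all_boot all_order all_algebra.
From mathcomp Require Import reals.
From mathcomp.real_closed Require Import complex.

Set Implicit Arguments.
Unset Strict Implicit.
Unset Printing Implicit Defensive.

Import GRing.Theory.
Local Open Scope ring_scope.

(** The curvature is built from [d] and the wedge product, and both can be
    written on [Omega^1] in terms of the products [s^i ∧ s^j].  The Leibniz
    rule gives
      [d (a s^j) = (∂_i a) s^i ∧ s^j + a d s^j],
    torsion freeness turns [d s^k] into [- 1/2 Γ^k_{ij} s^i ∧ s^j], and
    centrality of [s] lets the second connection coefficient move to the left
    in [S^α_{iτ} s^i ∧ S^τ_{jβ} s^j].  Collecting terms,
      [R_S e^α = F^α_{ijβ} s^i ∧ s^j ⊗ e^β],
    where [F] is the first factor of the formula ([curvature_coordinates]).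
    The elements [s^i ∧ s^j] need not be linearly independent, so [F] is not
    a family of coordinates of [R_S]; it does not have to be, since the action
    of [Omega^2] is a well-defined left linear map and its value on each
    [s^i ∧ s^j ⊗ e^β] is prescribed by the Clifford relations.  Applying it
    lands in [S], where [e] is a basis and coefficients can be compared. *)

(** * Sums and coordinates in bimodules and tensor products *)

Section Bimodules.
Variables (A : pzRingType) (M N : bimodType A).

Lemma tens0l (n : N) : (0 : M) ⊗ n = 0.
Proof. by rewrite -(scale0r (0 : M)) tensZl scale0r. Qed.

Lemma tens_suml (I : finType) (w : I -> M) (n : N) :
  (\sum_i w i) ⊗ n = \sum_i w i ⊗ n.
Proof.
by apply: (big_morph (fun m => m ⊗ n)) => [m m'|]; rewrite ?tensDl ?tens0l.
Qed.

Lemma tlift_sum (P : zmodType) (f : M -> N -> P) (fP : balanced f)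
    (I : finType) (t : I -> tensor M N) :
  tlift f (\sum_i t i) = \sum_i tlift f (t i).
Proof. exact: (big_morph _ (tliftD fP) (tlift0 fP)). Qed.

Lemma bimodule_map_sum (f : M -> N) (fP : bimodule_map f) (I : finType)
    (m : I -> M) :
  f (\sum_i m i) = \sum_i f (m i).
Proof.
have [fL _] := fP.
have fD x y : f (x + y) = f x + f y by have := fL 1 x y; rewrite !scale1r.
by apply: (big_morph f) => //; apply: (addrI (f 0)); rewrite -fD !addr0.
Qed.

Lemma bimodule_mapZ (f : M -> N) (fP : bimodule_map f) (a : A) (m : M) :
  f (a *: m) = a *: f m.
Proof.
have [fL _] := fP.
have f0 : f 0 = 0.
  by apply: (addrI (f 0)); rewrite -{1}(scale1r (f 0)) -fL scale1r !addr0.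
by have := fL a m 0; rewrite f0 !addr0.
Qed.

Lemma central_basis_coord_inj (I : finType) (s : I -> M) (a b : I -> A) :
  central_basis s -> \sum_i a i *: s i = \sum_i b i *: s i -> a =1 b.
Proof.
move=> [sB _] ab; have [c [_ cU]] := sB (\sum_i a i *: s i).
have ca : c = finfun a by apply: cU; apply: eq_bigr => i _; rewrite ffunE.
have cb : c = finfun b.
  by apply: cU; rewrite ab; apply: eq_bigr => i _; rewrite ffunE.
by move=> i; rewrite -(ffunE a) -ca cb ffunE.
Qed.

End Bimodules.

(** * The curvature in central bases *)

Section Curvature.
Variables (K : fieldType) (A : algType K) (Omega : exterior_algebra A).

Lemma wedge2_suml (I : finType) (w : I -> Omega 1%N) (x : Omega 1%N) :
  wedge2 (\sum_i w i) x = \sum_i wedge2 (w i) x.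
Proof.
have [wD _ _] := wedge2_balanced Omega.
apply: (big_morph (fun w => wedge2 w x)) => [y z|]; first exact: wD.
by apply: (addrI (wedge2 0 x)); rewrite -wD !addr0.
Qed.

Lemma wedge_tens_scalel (E : bimodType A) (a : A) (w : Omega 1%N)
    (t : tensor (Omega 1%N) E) :
  wedge_tens (a *: w) t = a *: wedge_tens w t.
Proof.
rewrite /wedge_tens; elim/tens_ind: t => [|y x|t u ht hu].
- by rewrite !(tlift0 (wedge_tens_balanced _ _)) scaler0.
- by rewrite !(tliftE (wedge_tens_balanced _ _)) wedge2_scalel tensZl.
- by rewrite !(tliftD (wedge_tens_balanced _ _)) ht hu scalerDr.
Qed.

Variables (I : finType) (s : I -> Omega 1%N).

(** Balancing over [A] moves a coefficient from the right factor to the right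
    of the left factor; centrality then carries it out to the left. *)
Lemma wedge2_central_scaler (a : A) (i : I) (x : Omega 1%N) :
  central_basis s -> wedge2 (s i) (a *: x) = a *: wedge2 (s i) x.
Proof.
move=> [_ sC]; have [_ _ wb] := wedge2_balanced Omega.
by rewrite -wb -sC wedge2_scalel.
Qed.

Lemma torsion_free_dif_basis
    (nabla : Omega 1%N -> tensor (Omega 1%N) (Omega 1%N))
    (G : I -> I -> A) (k : I) :
  torsion_free nabla ->
  nabla (s k) = \sum_i \sum_j G i j *: (s i ⊗ s j) ->
  dif Omega (s k) = \sum_i \sum_j G i j *: wedge2 (s i) (s j).
Proof.
move=> <- ->; have wb := wedge2_balanced Omega.
rewrite (tlift_sum wb); apply: eq_bigr => i _.
rewrite (tlift_sum wb); apply: eq_bigr => j _.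
by rewrite -tensZl (tliftE wb) wedge2_scalel.
Qed.

Variables (partial : I -> A -> A).
Hypothesis s_basis : central_basis s.
Hypothesis partialE : forall a : A, d0 Omega a = \sum_i partial i a *: s i.
Variable G : I -> I -> I -> A.
Hypothesis dif_s :
  forall k, dif Omega (s k) = \sum_i \sum_j G k i j *: wedge2 (s i) (s j).

(** By the Leibniz rule [d a_j ∧ s^j] only contributes products ending in
    [s^j], whereas [a_k d s^k] contributes to every [s^i ∧ s^j].  Hence the
    formula is about a whole combination of basis forms: only the coefficient
    of [s^i ∧ s^j] in the total is simple. *)
Lemma dif_coordinates (a : I -> A) :
  dif Omega (\sum_j a j *: s j) =
  \sum_i \sum_j (partial i (a j) + \sum_k a k * G k i j) *: wedge2 (s i) (s j).
Proof.
have d_0 : dif Omega (0 : Omega 1%N) = 0.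
  by apply: (addrI (dif Omega (0 : Omega 1%N))); rewrite -difD !addr0.
rewrite (big_morph _ (@difD _ _ Omega 1) d_0).
transitivity (\sum_j (\sum_i partial i (a j) *: wedge2 (s i) (s j))
   + \sum_k \sum_i \sum_j (a k * G k i j) *: wedge2 (s i) (s j)).
  rewrite -big_split; apply: eq_bigr => j _ /=.
  rewrite d_scale partialE wedge2_suml dif_s; congr (_ + _).
    by apply: eq_bigr => i _; rewrite wedge2_scalel.
  rewrite scaler_sumr; apply: eq_bigr => i _.
  by rewrite scaler_sumr; apply: eq_bigr => k _; rewrite scalerA.
(* Both sums are brought to the order [i], [j], with [k] innermost. *)
rewrite exchange_big [X in _ + X]exchange_big -big_split; apply: eq_bigr => i _.
rewrite /= [X in _ + X]exchange_big -big_split; apply: eq_bigr => j _ /=.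
by rewrite scalerDl scaler_suml.
Qed.

Variables (E : bimodType A) (J : finType) (e : J -> E).
Variables (nabla : E -> tensor (Omega 1%N) E).
Variable sigma : tensor E (Omega 1%N) -> tensor (Omega 1%N) E.
Hypothesis nabla_connection : bimodule_connection nabla sigma.
Variable c : J -> I -> J -> A.
Hypothesis nabla_e :
  forall alpha, nabla (e alpha) = \sum_i \sum_beta c alpha i beta *: (s i ⊗ e beta).

Lemma wedge_tens_connection (i : I) (tau : J) :
  wedge_tens (s i) (nabla (e tau)) =
  \sum_j \sum_beta c tau j beta *: (wedge2 (s i) (s j) ⊗ e beta).
Proof.
have wb := wedge_tens_balanced E (s i); rewrite nabla_e /wedge_tens.
rewrite (tlift_sum wb); apply: eq_bigr => j _.
rewrite (tlift_sum wb); apply: eq_bigr => beta _.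
by rewrite -tensZl (tliftE wb) wedge2_central_scaler // tensZl.
Qed.

(** Grouping [nabla e^alpha] by the spinor index, as
    [(c^alpha_{i beta} s^i) ⊗ e^beta], lets [dif_coordinates] apply to the left
    factors.  The [s^i ∧ s^j] may satisfy linear relations, so these
    coefficients are one choice among many, namely the one read off directly
    from the connection without symmetrising in [i] and [j]. *)
Lemma curvature_coordinates (alpha : J) :
  curvature nabla (e alpha) =
  \sum_i \sum_j \sum_beta
    (partial i (c alpha j beta) + \sum_k c alpha k beta * G k i j
     - \sum_tau c alpha i tau * c tau j beta)
    *: (wedge2 (s i) (s j) ⊗ e beta).
Proof.
have cb := curvature_balanced nabla_connection.
have split_beta : nabla (e alpha) =
    \sum_beta (\sum_i c alpha i beta *: s i) ⊗ e beta.
  rewrite nabla_e exchange_big; apply: eq_bigr => beta _.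
  by rewrite tens_suml; apply: eq_bigr => i _; rewrite tensZl.
have wedge_sum tau : wedge_tens (\sum_i c alpha i tau *: s i) (nabla (e tau)) =
    \sum_i \sum_j \sum_beta
      (c alpha i tau * c tau j beta) *: (wedge2 (s i) (s j) ⊗ e beta).
  have w0 : wedge_tens 0 (nabla (e tau)) = 0.
    by rewrite -(scale0r (0 : Omega 1%N)) wedge_tens_scalel scale0r.
  rewrite (big_morph (fun w => wedge_tens w (nabla (e tau)))
             (fun w w' => wedge_tensDl w w' (nabla (e tau))) w0).
  apply: eq_bigr => i _; rewrite wedge_tens_scalel wedge_tens_connection.
  rewrite scaler_sumr; apply: eq_bigr => j _.
  by rewrite scaler_sumr; apply: eq_bigr => beta _; rewrite scalerA.
rewrite /curvature split_beta (tlift_sum cb).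
under eq_bigr => beta _ do rewrite (tliftE cb) dif_coordinates wedge_sum.
rewrite sumrB.
under [RHS]eq_bigr => i _ do (under eq_bigr => j _ do
  (under eq_bigr => beta _ do rewrite scalerBl; rewrite sumrB); rewrite sumrB).
rewrite sumrB; congr (_ - _).
  under eq_bigr => beta _ do rewrite tens_suml.
  rewrite exchange_big; apply: eq_bigr => i _ /=.
  under eq_bigr => beta _ do rewrite tens_suml.
  rewrite exchange_big; apply: eq_bigr => j _ /=.
  by apply: eq_bigr => beta _; rewrite tensZl.
rewrite exchange_big; apply: eq_bigr => i _ /=.
rewrite exchange_big; apply: eq_bigr => j _ /=.
rewrite exchange_big; apply: eq_bigr => beta _ /=.
by rewrite scaler_suml.
Qed.

End Curvature.

(** * The Clifford action on the curvature *)

Theorem lemma2p2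
  (R : realType) (A : algType R[i])
  (A_center : center_is_scalars A)
  (Omega : exterior_algebra A)
  (I : finType) (s : I -> Omega 1%N)
  (s_basis : central_basis s)
  (partial : I -> A -> A)
  (partialE : forall a : A, d0 Omega a = \sum_i partial i a *: s i)
  (glow : I -> I -> A)
  (ip : tensor (Omega 1%N) (Omega 1%N) -> A^o)
  (metric : quantum_metric s glow ip)
  (g : I -> I -> R[i])
  (gE : forall i j, ip (s i ⊗ s j) = (g i j)%:A)
  (nabla : Omega 1%N -> tensor (Omega 1%N) (Omega 1%N))
  (sigma : tensor (Omega 1%N) (Omega 1%N) -> tensor (Omega 1%N) (Omega 1%N))
  (nabla_connection : bimodule_connection nabla sigma)
  (Gamma : I -> I -> I -> A)
  (GammaE : forall i,
    nabla (s i) = \sum_j \sum_k (- 2^-1 *: Gamma i j k) *: (s j ⊗ s k))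
  (nabla_torsion_free : torsion_free nabla)
  (S : bimodType A) (J : finType) (e : J -> S)
  (e_basis : central_basis e)
  (nablaS : S -> tensor (Omega 1%N) S)
  (sigmaS : tensor S (Omega 1%N) -> tensor (Omega 1%N) S)
  (nablaS_connection : bimodule_connection nablaS sigmaS)
  (Sc : J -> I -> J -> A)
  (ScE : forall alpha,
    nablaS (e alpha) = \sum_i \sum_beta Sc alpha i beta *: (s i ⊗ e beta))
  (cliff : tensor (Omega 1%N) S -> S)
  (cliff_map : bimodule_map cliff)
  (C : I -> J -> J -> R[i])
  (CE : forall i alpha,
    cliff (s i ⊗ e alpha) = \sum_beta (C i alpha beta)%:A *: e beta)
  (phi : S -> S)
  (phi_map : bimodule_map phi)
  (phi_bij : bijective phi)
  (phic : J -> J -> R[i])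
  (phicE : forall alpha, phi (e alpha) = \sum_beta (phic alpha beta)%:A *: e beta)
  (kappa : R[i])
  (kappa_neq0 : kappa != 0)
  (cliff2 : tensor (Omega 2%N) S -> S)
  (cliff2_map : bimodule_map cliff2)
  (clifford_relations : forall i j alpha,
    cliff2 (wedge2 (s i) (s j) ⊗ e alpha) =
      \sum_beta \sum_gamma \sum_delta
        (C j alpha beta * C i beta gamma * phic gamma delta)%:A *: e delta
      - (kappa * g i j)%:A *: e alpha)
  (RS : J -> J -> A)
  (RSE : forall alpha,
    cliff2 (curvature nablaS (e alpha)) = \sum_beta RS alpha beta *: e beta) :
  forall alpha eta : J,
    RS alpha eta =
      \sum_i \sum_j \sum_beta
        (partial i (Sc alpha j beta)
         - 2^-1 *: (\sum_k Sc alpha k beta * Gamma k i j)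
         - \sum_tau Sc alpha i tau * Sc tau j beta)
        * (\sum_gamma \sum_delta C j beta gamma * C i gamma delta * phic delta eta
           - kappa * g i j * (beta == eta)%:R)%:A.
Proof.
move=> alpha eta.
have dif_s k := torsion_free_dif_basis nabla_torsion_free (GammaE k).
pose F i j beta := partial i (Sc alpha j beta)
  - 2^-1 *: (\sum_k Sc alpha k beta * Gamma k i j)
  - \sum_tau Sc alpha i tau * Sc tau j beta.
pose M i j beta eta := \sum_gamma \sum_delta
    C j beta gamma * C i gamma delta * phic delta eta
  - kappa * g i j * (beta == eta)%:R.
have curvE : curvature nablaS (e alpha) =
    \sum_i \sum_j \sum_beta F i j beta *: (wedge2 (s i) (s j) ⊗ e beta).
  rewrite (curvature_coordinates s_basis partialE dif_s nablaS_connection ScE).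
  apply: eq_bigr => i _; apply: eq_bigr => j _; apply: eq_bigr => beta _.
  congr ((_ + _ - _) *: _); rewrite -scaleNr scaler_sumr.
  by apply: eq_bigr => k _; rewrite scalerAr.
have cliffE i j beta : cliff2 (wedge2 (s i) (s j) ⊗ e beta) =
    \sum_zeta (M i j beta zeta)%:A *: e zeta.
  rewrite clifford_relations.
  under [RHS]eq_bigr => zeta _ do rewrite scalerBl scalerBl.
  rewrite sumrB; congr (_ - _).
    under [RHS]eq_bigr => zeta _ do
      (rewrite scaler_suml scaler_suml; under eq_bigr => gamma _ do
        rewrite scaler_suml scaler_suml).
    rewrite [RHS]exchange_big; apply: eq_bigr => gamma _ /=.
    by rewrite [RHS]exchange_big.
  (* The metric term only has a component along [e^beta]; the Kronecker delta
     spreads it over all [zeta]. *)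
  rewrite (bigD1 beta) //= eqxx mulr1 big1 ?addr0 // => zeta.
  by rewrite eq_sym => /negPf ->; rewrite mulr0 !scale0r.
have coordE : \sum_zeta RS alpha zeta *: e zeta = \sum_zeta
    (\sum_i \sum_j \sum_beta F i j beta * (M i j beta zeta)%:A) *: e zeta.
  under [RHS]eq_bigr => zeta _ do rewrite scaler_suml.
  rewrite -RSE curvE (bimodule_map_sum cliff2_map) [RHS]exchange_big.
  apply: eq_bigr => i _ /=; under [RHS]eq_bigr => zeta _ do rewrite scaler_suml.
  rewrite (bimodule_map_sum cliff2_map) [RHS]exchange_big.
  apply: eq_bigr => j _ /=; under [RHS]eq_bigr => zeta _ do rewrite scaler_suml.
  rewrite (bimodule_map_sum cliff2_map) [RHS]exchange_big.
  apply: eq_bigr => beta _ /=; rewrite (bimodule_mapZ cliff2_map) cliffE.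
  by rewrite scaler_sumr; apply: eq_bigr => zeta _; rewrite scalerA.
exact: (central_basis_coord_inj e_basis coordE eta).
Qed.
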